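(* Let $f(x,y)=\sum_{i=0}^{d}\binom{d}{i}a_ix^{d-i}y^i$ be a complex binary form of degree $d$, with $a_0,\dots,a_d\in\mathbb{C}$. Let $\beta_1,\beta_2,\dots,\beta_r\in\mathbb{C}$ be pairwise distinct, where $1\leq r\leq d$. Then the following are equivalent: (1) There exist $\lambda_1,\dots,\lambda_r\in\mathbb{C}\setminus\{0\}$ such that $f(x,y)=\sum_{k=1}^{r}\lambda_k(x+\beta_ky)^d$. (2) There exist $c_0,c_1,\dots,c_{r-1}\in\mathbb{C}$ such that all of the following hold: (a) $a_i=-(c_0a_{i-r}+c_1a_{i-r+1}+\cdots+c_{r-1}a_{i-1})$ for $i=r,r+1,\dots,d$; and define $a_i$ for $i>d$ inductively by the same formula $a_i=-(c_0a_{i-r}+c_1a_{i-r+1}+\cdots+c_{r-1}a_{i-1})$; (b) the $r\times r$ Hankel matrix $A_0=(a_{i+j-2})_{1\leq i,j\leq r}$ has rank $r$; (c) the eigenvalues of the matrix $A_0^{-1}A_1$, where $A_1=(a_{i+j-1})_{1\leq i,j\leq r}$, are $\beta_1,\beta_2,\dots,\beta_r$.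
   Context: Here $A_0$ is the matrix with rows $(a_0,\dots,a_{r-1}),(a_1,\dots,a_r),\dots,(a_{r-1},\dots,a_{2r-2})$ and $A_1$ the matrix with rows $(a_1,\dots,a_r),(a_2,\dots,a_{r+1}),\dots,(a_r,\dots,a_{2r-1})$, where entries with index larger than $d$ are those defined by the recursion in (a). *)

(* Defs.v *)
From mathcomp Require Import all_boot all_order all_algebra.
From mathcomp Require Import mpoly.

Set Implicit Arguments.
Unset Strict Implicit.
Unset Printing Implicit Defensive.

Import GRing.Theory.
Local Open Scope ring_scope.

Section Defs.
Variable K : fieldType.

Definition binary_form (d : nat) (a : 'I_d.+1 -> K) : {mpoly K[2]} :=
  \sum_(i < d.+1) (a i *+ 'C(d, i)) *: ('X_0 ^+ (d - i) * 'X_1 ^+ i).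

Definition linrec (r : nat) (c : 'I_r -> K) (b : nat -> K) (i : nat) : K :=
  - \sum_(j < r) c j * b (i - r + j)%N.

(* [ext_prefix a c n] lists the first [n] terms of the sequence that equals
   [a] up to index [d] and is continued by the recursion [linrec c]. *)
Fixpoint ext_prefix (d r : nat) (a : 'I_d.+1 -> K) (c : 'I_r -> K) (n : nat)
    : seq K :=
  if n is m.+1 then
    let s := ext_prefix a c m in
    rcons s (if insub m is Some i then a i else linrec c (nth 0 s) m)
  else [::].

Definition ext_coef (d r : nat) (a : 'I_d.+1 -> K) (c : 'I_r -> K) (n : nat)
    : K := nth 0 (ext_prefix a c n.+1) n.

(* With 0-based indices, [hankel r b 0] is A_0 and [hankel r b 1] is A_1. *)
Definition hankel (r : nat) (b : nat -> K) (s : nat) : 'M[K]_r :=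
  \matrix_(i < r, j < r) b (i + j + s)%N.

Section ExtCoefFacts.
Variables (d r : nat) (a : 'I_d.+1 -> K) (c : 'I_r -> K).

Lemma size_ext_prefix n : size (ext_prefix a c n) = n.
Proof. by elim: n => //= n IHn; rewrite size_rcons IHn. Qed.

Lemma nth_ext_prefix n m : (m < n)%N -> nth 0 (ext_prefix a c n) m = ext_coef a c m.
Proof.
elim: n => // n IHn; rewrite ltnS leq_eqVlt => /predU1P[-> //|ltmn].
by rewrite /= nth_rcons size_ext_prefix ltmn IHn.
Qed.

Lemma ext_coef_ord (i : 'I_d.+1) : ext_coef a c i = a i.
Proof.
by rewrite /ext_coef /= nth_rcons size_ext_prefix ltnn eqxx valK.
Qed.

Lemma ext_coef_rec n :
  (r <= d)%N -> (d < n)%N -> ext_coef a c n = linrec c (ext_coef a c) n.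
Proof.
move=> le_rd lt_dn.
rewrite {1}/ext_coef /= nth_rcons size_ext_prefix ltnn eqxx insubN -?leqNgt //.
congr (- _); apply: eq_bigr => j _; rewrite nth_ext_prefix //.
have le_rn : (r <= n)%N by apply: leq_trans le_rd (ltnW lt_dn).
by rewrite -[X in (_ < X)%N](subnK le_rn) ltn_add2l.
Qed.

End ExtCoefFacts.
End Defs.

(* Main.v *)
Require Import Defs.
From mathcomp Require Import all_boot all_order all_algebra.
From mathcomp Require Import complex reals mpoly.

Set Implicit Arguments.
Unset Strict Implicit.
Unset Printing Implicit Defensive.

Local Open Scope ring_scope.
Local Open Scope complex_scope.

(** Comparing coefficients, (1) says that [a i = \sum_k lambda k * beta k ^+ i]
for [i <= d].  A sequence [b] of this form satisfies the recursion whose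
characteristic polynomial is [\prod_k ('X - beta k)], and its Hankel matrices
factor as [A0 = V D V^T] and [A1 = V D B V^T], with [V] the Vandermonde matrix
of [beta], [D] the diagonal matrix of [lambda] and [B] that of [beta]; hence
[\det (A1 - z A0)] vanishes exactly at the [beta k].  Conversely, if
[u A1 = z u A0] with [u != 0], then [w n = \sum_i u i * b (i + n)] satisfies the
recursion and is geometric of ratio [z] up to index [r], so [z] is a root of the
characteristic polynomial.  Thus all the [beta k] are roots; fitting
[b i = \sum_k lambda k * beta k ^+ i] for [i < r] (Vandermonde) propagates by
the recursion, and [A0 = V D V^T] forces [lambda k != 0]. *)

Import GRing.Theory Num.Theory.

Definition power_sum (K : fieldType) (r : nat) (lambda beta : 'I_r -> K)
    (n : nat) : K := \sum_(k < r) lambda k * beta k ^+ n.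

Section BinaryForm.
Variable K : numFieldType.

Lemma binary_form_inj d (a a' : 'I_d.+1 -> K) :
  binary_form a = binary_form a' -> a =1 a'.
Proof.
(* Dehomogenize: ['X_0] is sent to [1] and ['X_1] to ['X]. *)
pose h (i : 'I_2) : {poly K} := if i == 0 then 1 else 'X.
have dehomE (e : 'I_d.+1 -> K) :
    mmap (@polyC K) h (binary_form e)
    = \poly_(i < d.+1) (e (inord i) *+ 'C(d, i)).
  rewrite poly_def raddf_sum /=; apply: eq_bigr => i _.
  rewrite mmapZ rmorphM !rmorphXn /= !mmapX !mmap1U /h /= expr1n mul1r.
  by rewrite inord_val mul_polyC.
move=> /(congr1 (mmap (@polyC K) h)); rewrite !dehomE => eq_poly i.
have := congr1 (fun p : {poly K} => p`_i) eq_poly.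
rewrite !coef_poly ltn_ord inord_val => /eqP.
(* The factor ['C(d, i)] cancels: it is positive because [i <= d], hence nonzero in characteristic
   zero. *)
rewrite -[a i *+ _]mulr_natr -[a' i *+ _]mulr_natr -subr_eq0 -mulrBl mulf_eq0.
rewrite pnatr_eq0 -[_ == 0%N]negbK -lt0n bin_gt0 -ltnS ltn_ord orbF subr_eq0.
by move/eqP.
Qed.

Lemma binary_form_power_sum d r (lambda beta : 'I_r -> K) :
  binary_form (fun i : 'I_d.+1 => power_sum lambda beta i)
  = \sum_(k < r) lambda k *: (('X_0 + beta k *: 'X_1) ^+ d : {mpoly K[2]}).
Proof.
under [RHS]eq_bigr do rewrite exprDn scaler_sumr.
rewrite exchange_big; apply: eq_bigr => i _ /=.
rewrite /power_sum -sumrMnl scaler_suml; apply: eq_bigr => k _.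
by rewrite exprZn -scalerAr -scalerMnl -!scalerMnr scalerA.
Qed.

Lemma binary_form_eq_sum_powers d r (a : 'I_d.+1 -> K)
    (lambda beta : 'I_r -> K) :
  binary_form a
    = \sum_(k < r) lambda k *: (('X_0 + beta k *: 'X_1) ^+ d : {mpoly K[2]})
  <-> forall i, a i = power_sum lambda beta i.
Proof.
rewrite -binary_form_power_sum; split; first exact: binary_form_inj.
by move=> eq_a; apply: eq_bigr => i _; rewrite eq_a.
Qed.

End BinaryForm.

Section Recursion.
Variables (K : fieldType) (r : nat).
Implicit Types (c lambda beta : 'I_r -> K) (u v b : nat -> K).

(** From index [n >= r] on, each term is determined by the [r] terms before it. The starting index
    stays free because it is used both with [n = d.+1] and with [n = r]. *)
Lemma linrec_unique c n u v :
    (r <= n)%N -> {in [pred i | (i < n)%N], u =1 v} ->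
    (forall i, (n <= i)%N -> u i = linrec c u i) ->
    (forall i, (n <= i)%N -> v i = linrec c v i) ->
  u =1 v.
Proof.
move=> le_rn eq_uv u_rec v_rec i.
elim/ltn_ind: i => i IHi; have [lt_in | le_ni] := ltnP i n; first exact: eq_uv.
rewrite u_rec // v_rec //; congr (- _); apply: eq_bigr => j _; rewrite IHi //.
have le_ri := leq_trans le_rn le_ni.
by rewrite -[X in (_ < X)%N](subnK le_ri) ltn_add2l.
Qed.

(** Multiplying the root equation by [beta k ^+ (i - r)] gives the recursion for each geometric
    sequence, and the recursion is linear. *)
Lemma power_sum_linrec c lambda beta i :
    (forall k, beta k ^+ r = - \sum_(j < r) c j * beta k ^+ j) -> (r <= i)%N ->
  power_sum lambda beta i = linrec c (power_sum lambda beta) i.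
Proof.
move=> beta_root le_ri; rewrite /linrec /power_sum.
under [in RHS]eq_bigr do rewrite mulr_sumr.
rewrite exchange_big -sumrN; apply: eq_bigr => k _ /=.
rewrite -{1}(subnK le_ri) exprD beta_root !mulrN mulr_sumr mulr_sumr.
by congr (- _); apply: eq_bigr => j _; rewrite exprD [RHS]mulrCA (mulrCA (c j)).
Qed.

(** The leading coefficient, which is 1, is left out; the others serve as the [c] of condition
    (a). *)
Definition prod_XsubC_coef beta (j : 'I_r) : K :=
  (\prod_(k < r) ('X - (beta k)%:P))`_j.

Lemma prod_XsubC_coef_root beta k :
  beta k ^+ r = - \sum_(j < r) prod_XsubC_coef beta j * beta k ^+ j.
Proof.
pose p := \prod_(k < r) ('X - (beta k)%:P).
have size_p : size p = r.+1 by rewrite /p -big_enum size_prod_XsubC size_enum_ord.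
have : p.[beta k] = 0.
  by rewrite horner_prod (bigD1 k) //= hornerXsubC subrr mul0r.
have -> : p.[beta k] = \sum_(j < r) p`_j * beta k ^+ j + beta k ^+ r.
  rewrite horner_coef size_p big_ord_recr /=; congr (_ + _).
  have /monicP : p \is monic by apply: monic_prod_XsubC.
  by rewrite lead_coefE size_p /= => ->; rewrite mul1r.
by move/eqP; rewrite addrC addr_eq0 => /eqP.
Qed.

End Recursion.

Section Hankel.
Variables (K : fieldType) (r : nat).
Implicit Types (c lambda beta : 'I_r -> K) (b : nat -> K).

Lemma Vandermonde_unit beta :
  injective beta -> Vandermonde r (\row_k beta k) \in unitmx.
Proof.
move=> beta_inj; rewrite unitmxE unitfE det_Vandermonde.
apply/prodf_neq0 => i _; apply/prodf_neq0 => j lt_ij; rewrite !mxE subr_eq0.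
by apply: contraTneq lt_ij => /beta_inj ->; rewrite ltnn.
Qed.

Lemma hankel_power_sum lambda beta b s :
    b =1 power_sum lambda beta ->
  hankel r b s = Vandermonde r (\row_k beta k)
    *m diag_mx (\row_k (lambda k * beta k ^+ s))
    *m (Vandermonde r (\row_k beta k))^T.
Proof.
move=> bE; apply/matrixP => i j; rewrite !mxE bE; apply: eq_bigr => k _.
by rewrite mul_mx_diag !mxE !exprD (mulrAC (beta k ^+ i)) mulrA (mulrCA (lambda k)).
Qed.

(** Factoring [invmx A] out of [invmx A *m B - z%:M] removes the inverse from the eigenvalue
    condition. *)
Lemma eigenvalue_invmx_mul (A B : 'M[K]_r) z :
  A \in unitmx -> eigenvalue (invmx A *m B) z = (\det (B - z *: A) == 0).
Proof.
move=> uA; rewrite /eigenvalue kermx_eq0 row_free_unit.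
have -> : invmx A *m B - z%:M = invmx A *m (B - z *: A).
  by rewrite mulmxBr -scalemxAr mulVmx // scalemx1.
by rewrite unitmx_mul unitmx_inv uA unitmxE unitfE negbK.
Qed.

Lemma hankel_unit_power_sum lambda beta b :
    injective beta -> b =1 power_sum lambda beta ->
  (hankel r b 0 \in unitmx) = [forall k, lambda k != 0].
Proof.
move=> beta_inj bE; rewrite (hankel_power_sum 0 bE).
rewrite !unitmx_mul unitmx_tr Vandermonde_unit // andbT unitmxE unitfE det_diag.
apply/prodf_neq0/forallP => [lam0 k | lam0 k _].
  by have := lam0 k isT; rewrite mxE expr0 mulr1.
by rewrite mxE expr0 mulr1.
Qed.

(** The pencil is [V D V^T] with [D] diagonal of entries [lambda k * (beta k - z)], and [V] is
    invertible. *)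
Lemma det_hankel_pencil_power_sum lambda beta b z :
    injective beta -> (forall k, lambda k != 0) -> b =1 power_sum lambda beta ->
  \det (hankel r b 1 - z *: hankel r b 0) = 0 <-> exists k, z = beta k.
Proof.
move=> beta_inj lam0 bE; set V := Vandermonde r (\row_k beta k).
have V0 : \det V != 0 by rewrite -unitfE -unitmxE Vandermonde_unit.
have -> : hankel r b 1 - z *: hankel r b 0
    = V *m diag_mx (\row_k (lambda k * (beta k - z))) *m V^T.
  rewrite (hankel_power_sum 0 bE) (hankel_power_sum 1 bE) -/V.
  rewrite scalemxAl -mulmxBl scalemxAr -mulmxBr; congr (_ *m _ *m _).
  apply/matrixP => i j; rewrite !mxE expr0 mulr1 expr1 mulrnAr -mulrnBl.
  by rewrite mulrBr [z * _]mulrC.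
rewrite !det_mulmx det_tr det_diag; split=> [/eqP | [k ->]].
  rewrite !mulf_eq0 (negPf V0) orbF /= => /prodf_eq0[k _].
  rewrite mxE mulf_eq0 (negPf (lam0 k)) subr_eq0 /= => /eqP <-.
  by exists k.
by rewrite (bigD1 k) //= mxE subrr mulr0 mul0r mulr0 mul0r.
Qed.

Lemma hankel_eigenvalue_root c b z :
    (0 < r)%N -> (forall i, (r <= i)%N -> b i = linrec c b i) ->
    hankel r b 0 \in unitmx ->
    eigenvalue (invmx (hankel r b 0) *m hankel r b 1) z ->
  z ^+ r = - \sum_(j < r) c j * z ^+ j.
Proof.
move=> r_gt0 b_rec uA0 /eigenvalueP[v vE v0].
(* Eigenvectors are row vectors here, so [u = v A0^-1] satisfies both [u A0 = v] and
   [u A1 = z v]. *)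
have [u uA0E] : exists u, u *m hankel r b 0 = v.
  by exists (v *m invmx (hankel r b 0)); rewrite mulmxKV.
pose w n := \sum_(i < r) u 0 i * b (i + n)%N.
have uA1E : u *m hankel r b 1 = z *: v.
  by rewrite -vE -uA0E -mulmxA mulKVmx.
have w0E (j : 'I_r) : w j = v 0 j.
  by rewrite -uA0E mxE; apply: eq_bigr => i _; rewrite mxE addn0.
have w1E (j : 'I_r) : w j.+1 = z * v 0 j.
  have := congr1 (fun M : 'rV_r => M 0 j) uA1E; rewrite [RHS]mxE => <-.
  by rewrite mxE; apply: eq_bigr => i _; rewrite mxE addn1 addnS.
(* The entries of [u A0] are [w 0, ..., w (r-1)] and those of [u A1] are [w 1, ..., w r]; the last
   column of [A1] is what reaches [n = r]. *)
have w_geom n : (n <= r)%N -> w n = z ^+ n * w 0%N.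
  elim: n => [_|n IHn lt_nr]; first by rewrite mul1r.
  by rewrite (w1E (Ordinal lt_nr)) -w0E IHn 1?ltnW // exprS mulrA.
(* If [w 0] vanished, so would every entry [w j] of [v]. *)
have w_nz : w 0%N != 0.
  apply: contra v0 => /eqP w00; apply/eqP/rowP => j.
  by rewrite -w0E w_geom 1?ltnW // w00 mulr0 mxE.
have w_rec : w r = - \sum_(j < r) c j * w j.
  rewrite /w; under [in RHS]eq_bigr do rewrite mulr_sumr.
  rewrite exchange_big -sumrN; apply: eq_bigr => i _ /=.
  rewrite b_rec ?leq_addl // /linrec addnK mulrN mulr_sumr.
  by congr (- _); apply: eq_bigr => j _; rewrite mulrCA.
apply: (mulIf w_nz); rewrite -w_geom // w_rec mulNr mulr_suml; congr (- _).
by apply: eq_bigr => j _; rewrite w_geom 1?ltnW // mulrA.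
Qed.

Lemma power_sum_interpolation beta b :
    injective beta ->
  exists lambda, forall i, (i < r)%N -> b i = power_sum lambda beta i.
Proof.
move=> /Vandermonde_unit uV; set V := Vandermonde _ _ in uV.
pose x := invmx V *m \col_(i < r) b i.
exists (fun k => x k 0) => i lt_ir.
have : V *m x = \col_(i < r) b i by rewrite mulKVmx.
move=> /matrixP/(_ (Ordinal lt_ir) 0); rewrite !mxE /= => <-.
by apply: eq_bigr => k _; rewrite !mxE mulrC.
Qed.

End Hankel.

Theorem theorem3p1 (R : realType) (d r : nat) (a : 'I_d.+1 -> R[i])
    (beta : 'I_r -> R[i])
    (beta_inj : injective beta) (r_ge1 : (1 <= r)%N) (r_le_d : (r <= d)%N) :
  (exists lambda : 'I_r -> R[i],
     (forall k, lambda k != 0) /\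
     binary_form a =
       \sum_(k < r) lambda k *: (('X_0 + beta k *: 'X_1) ^+ d : {mpoly R[i][2]}))
  <->
  (exists c : 'I_r -> R[i],
     let b := ext_coef a c in
     let A0 := hankel r b 0 in
     let A1 := hankel r b 1 in
     [/\ (forall i, (r <= i <= d)%N -> b i = linrec c b i),
         \rank A0 = r
       & forall z : R[i],
           eigenvalue (invmx A0 *m A1) z <-> (exists k, z = beta k)]).
Proof.
split=> [[lambda [lam0 /binary_form_eq_sum_powers aE]] | [c [b_rec_d rankA0 eigA]]].
  pose c := prod_XsubC_coef beta; exists c => b A0 A1.
  have s_rec i : (r <= i)%N ->
      power_sum lambda beta i = linrec c (power_sum lambda beta) i.
    by apply: power_sum_linrec; apply: prod_XsubC_coef_root.
  have bE : b =1 power_sum lambda beta.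
    (* The comparison starts at [d.+1]: up to [d] the sequence [b] is just [a], and only beyond does
       it follow the recursion by construction. *)
    apply: (@linrec_unique _ _ c d.+1); first exact: leqW.
    - by move=> i lt_id; rewrite -(aE (Ordinal lt_id)) -(ext_coef_ord a c).
    - by move=> i; apply: ext_coef_rec.
    - by move=> i lt_di; apply/s_rec/(leq_trans r_le_d)/ltnW.
  have uA0 : A0 \in unitmx.
    by rewrite (hankel_unit_power_sum beta_inj bE); apply/forallP.
  split=> [i /andP[le_ri _]||z].
  - by rewrite bE s_rec //; congr (- _); apply: eq_bigr => j _; rewrite bE.
  - by apply/eqP; rewrite -[_ == r]/(row_free A0) row_free_unit.
  - rewrite eigenvalue_invmx_mul //.
    rewrite -(det_hankel_pencil_power_sum z beta_inj lam0 bE).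
    by split=> /eqP.
set b := ext_coef a c in b_rec_d rankA0 eigA.
set A0 := hankel r b 0 in rankA0 eigA.
have uA0 : A0 \in unitmx by rewrite -row_free_unit /row_free rankA0.
have b_rec i : (r <= i)%N -> b i = linrec c b i.
  move=> le_ri; have [le_id | lt_di] := leqP i d; last exact: ext_coef_rec.
  by rewrite b_rec_d // le_ri.
have beta_root k : beta k ^+ r = - \sum_(j < r) c j * beta k ^+ j.
  by apply: (hankel_eigenvalue_root r_ge1 b_rec uA0); apply/eigA; exists k.
have [lambda lambdaE] := power_sum_interpolation b beta_inj.
have bE : b =1 power_sum lambda beta.
  (* The comparison now starts at [r]: [b] obeys the recursion from there on, and so does the power
     sum since all [beta k] are characteristic roots. *)
  by apply: (@linrec_unique _ _ c r) => // i; apply: power_sum_linrec.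
exists lambda; split.
  by apply/forallP; rewrite -(hankel_unit_power_sum beta_inj bE).
apply/binary_form_eq_sum_powers => i.
by rewrite -(ext_coef_ord a c); apply: bE.
Qed.
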